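(* The first order partial differential equation $$u_t+a(x,t)u_x=f(u)\,b(x,t),\qquad u(x,0)=\phi(x),$$ can be reduced to the equation $$\frac{du}{f(u)}=b(x(t),t)\,dt .$$ Furthermore, let $F(u)=B(t)$, where $B(t)=b(x(t),t)$ and $F(u(x_0,0))=b(x_0,0)$. Then the general solution of the initial value problem above is easily determined by solving the equation $$F(u)=F(\phi(x_0))+\int_0^t b(x(s),s)\,ds .$$
   Context: Here $u$ is the unknown function of $(x,t)\in\mathbb{R}^2$, and $a(x,t)$, $b(x,t)$, $f(u)$ and $\phi(x)$ are given functions. The function $x(t)$ is the solution of $\frac{dx(t)}{dt}=a(x(t),t)$, $x(0)=x_0$. Along $x(t)$ the partial differential equation becomes $\frac{d}{dt}u(x(t),t)=f(u(x(t),t))\,b(x(t),t)$, and in the reduced equation $u$ stands for $u(x(t),t)$.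
   Formalization: ''F(u)=B(t), F(u(x0,0))=b(x0,0)'' contradicts the final formula (take b=1), so F is an antiderivative of 1/f and dF(u)/dt=B(t); b is continuous, f is nonzero on the range of u considered, and for the converse characteristics from t=0 reach every point. *)

(* Defs.v *)
From Stdlib Require Import Reals.
From Coquelicot Require Import Coquelicot.
Open Scope R_scope.

Definition in_interval (lo hi : Rbar) (v : R) : Prop :=
  Rbar_lt lo v /\ Rbar_lt v hi.

(* Functions of the plane take their arguments in the order (x, t). Total
   differentiability is what makes the chain rule along a curve available;
   it guarantees that both partial derivatives [Derive] below exist. *)
Definition differentiable_plane (u : R -> R -> R) : Prop :=
  forall x t : R, differentiable_pt u x t.

Definition solves_ivp (a b : R -> R -> R) (f phi : R -> R)
    (u : R -> R -> R) : Prop :=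
  differentiable_plane u /\
  (forall x t : R,
     Derive (fun s => u x s) t + a x t * Derive (fun y => u y t) x
     = f (u x t) * b x t) /\
  (forall x : R, u x 0 = phi x).

(* x solves dx/dt = a(x(t),t), x(0) = x0, on the open time interval (T1,T2),
   possibly unbounded, containing 0. *)
Definition characteristic (a : R -> R -> R) (x0 : R) (T1 T2 : Rbar)
    (x : R -> R) : Prop :=
  in_interval T1 T2 0 /\ x 0 = x0 /\
  (forall t : R, in_interval T1 T2 t -> is_derive x t (a (x t) t)).

(* Every point of the plane is joined to the initial line t = 0 by a
   characteristic curve; otherwise the initial data cannot determine u. *)
Definition characteristics_cover (a : R -> R -> R) : Prop :=
  forall x1 t1 : R, exists (x0 : R) (T1 T2 : Rbar) (x : R -> R),
    characteristic a x0 T1 T2 x /\ in_interval T1 T2 t1 /\ x t1 = x1.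

(* du / f(u) = b(x(t),t) dt at time t, where u stands for u(x(t),t). It is
   meaningful only where f(u(x(t),t)) is nonzero. *)
Definition reduced_equation (b : R -> R -> R) (f : R -> R)
    (u : R -> R -> R) (x : R -> R) (t : R) : Prop :=
  exists du : R, is_derive (fun s => u (x s) s) t du /\
    du / f (u (x t) t) = b (x t) t.

(* F is meant to be an antiderivative of 1/f on the range of values considered. *)
Definition implicit_equation (b : R -> R -> R) (phi F : R -> R)
    (x0 : R) (x : R -> R) (t v : R) : Prop :=
  F v = F (phi x0) + RInt (fun s => b (x s) s) 0 t.

(* Main.v *)
Require Import Defs.
From Stdlib Require Import Reals Lra.
From Coquelicot Require Import Coquelicot.
Open Scope R_scope.

(** Along a characteristic [x] the chain rule turns the left-hand side of the
    partial differential equation into the total derivative of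
    [y t := u (x t) t] ([is_derive_along_characteristic]).  The equation
    restricted to the curve is therefore the separable equation
    [y' / f y = b (x t) t].  As [F] is an antiderivative of [1/f], the quotient
    [y' / f y] is the derivative of [F o y], so by the fundamental theorem of
    calculus the separated equation holds on the whole interval exactly when
    [F (y t)] equals [F (y 0)] plus the integral of [b] along the curve
    ([separation_of_variables]).

    The relation determines [y t], because [F] is injective where [1/f] does not
    vanish ([antiderivative_inj]).  Conversely, when characteristics through the
    initial line reach every point, an equation known along all of them is the
    partial differential equation at every point.  Moreover the implicit relation
    at [t = 0] reads [F (u x0 0) = F (phi x0)], from which injectivity recovers
    the initial condition. *)

(** * Calculus on open intervals and antiderivatives of [1/f] *)

Lemma in_interval_between (lo hi : Rbar) (p q v : R) :
  in_interval lo hi p -> in_interval lo hi q ->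
  Rmin p q <= v <= Rmax p q -> in_interval lo hi v.
Proof.
intros [Hp1 Hp2] [Hq1 Hq2] [H1 H2]; split.
- apply Rbar_lt_le_trans with (Rmin p q); [|exact H1].
  now apply Rmin_case.
- apply Rbar_le_lt_trans with (Rmax p q); [exact H2|].
  now apply Rmax_case.
Qed.

(** By the mean value theorem a coincidence [F v = F w] forces
    [(w - v) / f c = 0] for some [c] between [v] and [w], and [/ f c] is not 0. *)
Lemma antiderivative_inj (f F : R -> R) (lo hi : Rbar) :
  (forall v : R, in_interval lo hi v -> f v <> 0) ->
  (forall v : R, in_interval lo hi v -> is_derive F v (/ f v)) ->
  forall v w : R, in_interval lo hi v -> in_interval lo hi w ->
  F v = F w -> v = w.
Proof.
intros hf hF v w Hv Hw HFvw.
destruct (MVT_gen F v w (fun z => / f z)) as [c [Hc Heq]].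
- intros z Hz; apply hF.
  apply (in_interval_between _ _ v w); [assumption..|lra].
- intros z Hz; apply continuity_pt_filterlim.
  apply (ex_derive_continuous (V := R_NormedModule)).
  exists (/ f z); apply hF.
  now apply (in_interval_between _ _ v w).
- assert (Hfc : / f c <> 0).
  { apply Rinv_neq_0_compat, hf; now apply (in_interval_between _ _ v w). }
  rewrite HFvw, Rminus_diag in Heq.
  symmetry in Heq; apply Rmult_integral in Heq as [H|H]; [easy|lra].
Qed.

Lemma eq_plus_RInt_of_is_derive (G g : R -> R) (T1 T2 : Rbar) :
  in_interval T1 T2 0 ->
  (forall t : R, in_interval T1 T2 t -> continuous g t) ->
  (forall t : R, in_interval T1 T2 t -> is_derive G t (g t)) ->
  forall t : R, in_interval T1 T2 t -> G t = G 0 + RInt g 0 t.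
Proof.
intros H0 Hg HG t Ht.
rewrite (is_RInt_unique g 0 t (minus (G t) (G 0))).
- unfold minus, plus, opp; simpl; ring.
- apply (is_RInt_derive (V := R_CompleteNormedModule)); intros s Hs;
    [apply HG|apply Hg]; now apply (in_interval_between _ _ 0 t).
Qed.

Lemma is_derive_RInt_interval (g : R -> R) (T1 T2 : Rbar) :
  in_interval T1 T2 0 ->
  (forall t : R, in_interval T1 T2 t -> continuous g t) ->
  forall t : R, in_interval T1 T2 t -> is_derive (fun s => RInt g 0 s) t (g t).
Proof.
intros H0 Hg t Ht.
apply (is_derive_RInt (V := R_NormedModule) g _ 0 t); [|now apply Hg].
apply (locally_interval _ t T1 T2 (proj1 Ht) (proj2 Ht)).
intros s Hs1 Hs2.
apply (RInt_correct (V := R_CompleteNormedModule)),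
  (ex_RInt_continuous (V := R_CompleteNormedModule)).
intros r Hr; apply Hg; now apply (in_interval_between _ _ 0 s).
Qed.

(** * Separation of variables *)

Lemma is_derive_antiderivative_comp (f F y : R -> R) (lo hi : Rbar) (t dy : R) :
  (forall v : R, in_interval lo hi v -> is_derive F v (/ f v)) ->
  in_interval lo hi (y t) -> is_derive y t dy ->
  is_derive (fun s => F (y s)) t (dy / f (y t)).
Proof.
intros hF Hy Hdy.
apply (is_derive_comp (V := R_NormedModule) F y t (/ f (y t)) dy); [|exact Hdy].
now apply hF.
Qed.

(** Both sides say that [F o y] has derivative [g]: the left one because
    [(F o y)' = y' / f y], the right one by the two halves of the fundamental
    theorem of calculus.  Differentiability of [y] is a hypothesis because the
    integrated form only speaks of [F o y]. *)
Lemma separation_of_variables (f F y g : R -> R) (lo hi T1 T2 : Rbar) :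
  (forall v : R, in_interval lo hi v -> is_derive F v (/ f v)) ->
  in_interval T1 T2 0 ->
  (forall t : R, in_interval T1 T2 t -> continuous g t) ->
  (forall t : R, in_interval T1 T2 t -> in_interval lo hi (y t)) ->
  (forall t : R, in_interval T1 T2 t -> ex_derive y t) ->
  (forall t : R, in_interval T1 T2 t ->
     exists dy : R, is_derive y t dy /\ dy / f (y t) = g t) <->
  (forall t : R, in_interval T1 T2 t -> F (y t) = F (y 0) + RInt g 0 t).
Proof.
intros hF H0 Hg Hy Hdiff; split.
- intros Hred.
  apply (eq_plus_RInt_of_is_derive (fun s => F (y s)) g T1 T2 H0 Hg).
  intros t Ht; destruct (Hred t Ht) as [dy [Hdy <-]].
  apply (is_derive_antiderivative_comp f F y lo hi t dy hF (Hy t Ht) Hdy).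
- intros Himp t Ht; destruct (Hdiff t Ht) as [dy Hdy].
  exists dy; split; [exact Hdy|].
  pose proof (is_derive_antiderivative_comp f F y lo hi t dy hF (Hy t Ht) Hdy) as H1.
  assert (H2 : is_derive (fun s => F (y s)) t (g t)).
  { apply (is_derive_ext_loc (V := R_NormedModule)
             (fun s => F (y 0) + RInt g 0 s)).
    - apply (locally_interval _ t T1 T2 (proj1 Ht) (proj2 Ht)).
      intros s Hs1 Hs2; symmetry; apply Himp; now split.
    - rewrite <- (Rplus_0_l (g t)).
      apply (is_derive_plus (V := R_NormedModule) (fun _ => F (y 0))).
      + apply (is_derive_const (V := R_NormedModule)).
      + now apply (is_derive_RInt_interval g T1 T2). }
  apply is_derive_unique in H1; apply is_derive_unique in H2; congruence.
Qed.

(** * The equation along a characteristic *)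

Lemma is_derive_along_characteristic (a u : R -> R -> R) (x0 : R)
    (T1 T2 : Rbar) (x : R -> R) (t : R) :
  differentiable_plane u -> characteristic a x0 T1 T2 x -> in_interval T1 T2 t ->
  is_derive (fun s => u (x s) s) t
    (Derive (fun s => u (x t) s) t + a (x t) t * Derive (fun y => u y t) (x t)).
Proof.
intros Hu [_ [_ Hx]] Ht.
destruct (Hu (x t) t) as [lx [lt Hl]].
destruct (differentiable_pt_lim_unique _ _ _ _ _ Hl) as [-> ->].
replace (lt + a (x t) t * lx) with (lx * a (x t) t + lt * 1) by ring.
apply is_derive_Reals, (derivable_pt_lim_comp_2d u x (fun s => s)).
- exact Hl.
- now apply is_derive_Reals, Hx.
- apply derivable_pt_lim_id.
Qed.

Lemma continuous_along_characteristic (a b : R -> R -> R) (x0 : R)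
    (T1 T2 : Rbar) (x : R -> R) (t : R) :
  (forall x t : R, continuity_2d_pt b x t) ->
  characteristic a x0 T1 T2 x -> in_interval T1 T2 t ->
  continuous (fun s => b (x s) s) t.
Proof.
intros hb [_ [_ Hx]] Ht.
apply (continuous_comp_2 x (fun s => s) b).
- apply (ex_derive_continuous (V := R_NormedModule)).
  exists (a (x t) t); now apply Hx.
- apply continuous_id.
- now apply continuity_2d_pt_filterlim.
Qed.

Lemma pde_along_characteristic (a b : R -> R -> R) (f phi : R -> R)
    (u : R -> R -> R) (x0 : R) (T1 T2 : Rbar) (x : R -> R) (t : R) :
  solves_ivp a b f phi u -> characteristic a x0 T1 T2 x -> in_interval T1 T2 t ->
  is_derive (fun s => u (x s) s) t (f (u (x t) t) * b (x t) t).
Proof.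
intros [Hd [Hpde _]] Hx Ht.
rewrite <- Hpde.
now apply is_derive_along_characteristic with x0 T1 T2.
Qed.

Lemma reduced_along_characteristic (a b : R -> R -> R) (f phi : R -> R)
    (u : R -> R -> R) (x0 : R) (T1 T2 : Rbar) (x : R -> R) (t : R) :
  solves_ivp a b f phi u -> characteristic a x0 T1 T2 x -> in_interval T1 T2 t ->
  f (u (x t) t) <> 0 -> reduced_equation b f u x t.
Proof.
intros Hu Hx Ht Hf.
exists (f (u (x t) t) * b (x t) t); split.
- now apply pde_along_characteristic with a phi x0 T1 T2.
- now field.
Qed.

(** On one characteristic the reduced and implicit equations are the two forms
    of separation of variables, once the value at time 0 is the initial datum. *)
Lemma reduced_iff_implicit (a b : R -> R -> R) (f phi F : R -> R)
    (lo hi : Rbar) (u : R -> R -> R) (x0 : R) (T1 T2 : Rbar) (x : R -> R) :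
  (forall x t : R, continuity_2d_pt b x t) ->
  (forall v : R, in_interval lo hi v -> is_derive F v (/ f v)) ->
  differentiable_plane u -> u x0 0 = phi x0 ->
  characteristic a x0 T1 T2 x ->
  (forall t : R, in_interval T1 T2 t -> in_interval lo hi (u (x t) t)) ->
  (forall t : R, in_interval T1 T2 t -> reduced_equation b f u x t) <->
  (forall t : R, in_interval T1 T2 t ->
     implicit_equation b phi F x0 x t (u (x t) t)).
Proof.
intros hb hF Hu Hphi Hx Hrange.
assert (Hsep := separation_of_variables f F (fun s => u (x s) s)
                  (fun s => b (x s) s) lo hi T1 T2 hF (proj1 Hx)).
cbv beta in Hsep.
rewrite (proj1 (proj2 Hx)), Hphi in Hsep.
apply Hsep.
- intros t Ht; now apply continuous_along_characteristic with a x0 T1 T2.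
- exact Hrange.
- intros t Ht; eexists.
  exact (is_derive_along_characteristic a u x0 T1 T2 x t Hu Hx Ht).
Qed.

(** * From the characteristics back to the plane *)

(** A point is reached by some characteristic, and there the derivative of [u]
    along the curve is the left-hand side of the partial differential equation. *)
Lemma solves_ivp_of_reduced (a b : R -> R -> R) (f phi : R -> R)
    (u : R -> R -> R) :
  characteristics_cover a -> differentiable_plane u ->
  (forall x t : R, f (u x t) <> 0) ->
  (forall x : R, u x 0 = phi x) ->
  (forall (x0 : R) (T1 T2 : Rbar) (x : R -> R),
     characteristic a x0 T1 T2 x ->
     forall t : R, in_interval T1 T2 t -> reduced_equation b f u x t) ->
  solves_ivp a b f phi u.
Proof.
intros Hcov Hu Hf Hinit Hred; split; [exact Hu|split; [|exact Hinit]].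
intros x1 t1.
destruct (Hcov x1 t1) as [x0 [T1 [T2 [x [Hx [Ht Hx1]]]]]].
destruct (Hred x0 T1 T2 x Hx t1 Ht) as [du [Hdu Heq]].
pose proof (is_derive_along_characteristic a u x0 T1 T2 x t1 Hu Hx Ht) as Hchain.
apply is_derive_unique in Hdu; apply is_derive_unique in Hchain.
rewrite Hx1 in *.
rewrite <- Hchain, <- Heq, Hdu.
now field.
Qed.

(** Any characteristic that passes through [(x1, 0)] starts at [x1], so the
    implicit equation at time 0, where the integral is empty, compares
    [u x1 0] with [phi x1]. *)
Lemma initial_condition_of_implicit (a b : R -> R -> R) (f phi F : R -> R)
    (lo hi : Rbar) (u : R -> R -> R) :
  (forall v : R, in_interval lo hi v -> f v <> 0) ->
  (forall v : R, in_interval lo hi v -> is_derive F v (/ f v)) ->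
  characteristics_cover a ->
  (forall x : R, in_interval lo hi (phi x)) ->
  (forall x t : R, in_interval lo hi (u x t)) ->
  (forall (x0 : R) (T1 T2 : Rbar) (x : R -> R),
     characteristic a x0 T1 T2 x ->
     forall t : R, in_interval T1 T2 t ->
       implicit_equation b phi F x0 x t (u (x t) t)) ->
  forall x : R, u x 0 = phi x.
Proof.
intros hf hF Hcov Hphi Hrange Himp x1.
destruct (Hcov x1 0) as [x0 [T1 [T2 [x [Hx [H0 Hx1]]]]]].
specialize (Himp x0 T1 T2 x Hx 0 H0).
unfold implicit_equation in Himp.
rewrite RInt_point, Hx1 in Himp.
rewrite <- (proj1 (proj2 Hx)), Hx1 in Himp.
apply (antiderivative_inj f F lo hi hf hF); [apply Hrange|apply Hphi|].
rewrite Himp; apply Rplus_0_r.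
Qed.

Theorem proposition2 (a b : R -> R -> R) (f phi F : R -> R) (lo hi : Rbar)
  (hb : forall x t : R, continuity_2d_pt b x t)
  (hf : forall v : R, in_interval lo hi v -> f v <> 0)
  (hF : forall v : R, in_interval lo hi v -> is_derive F v (/ f v)) :
  (forall u : R -> R -> R, solves_ivp a b f phi u ->
    forall (x0 : R) (T1 T2 : Rbar) (x : R -> R),
    characteristic a x0 T1 T2 x ->
    (forall t : R, in_interval T1 T2 t ->
       is_derive (fun s => u (x s) s) t (f (u (x t) t) * b (x t) t)) /\
    ((forall t : R, in_interval T1 T2 t -> in_interval lo hi (u (x t) t)) ->
     forall t : R, in_interval T1 T2 t ->
       reduced_equation b f u x t /\
       is_derive (fun s => F (u (x s) s)) t (b (x t) t) /\
       (forall v : R, in_interval lo hi v ->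
          (implicit_equation b phi F x0 x t v <-> v = u (x t) t)))) /\
  (characteristics_cover a ->
   (forall x : R, in_interval lo hi (phi x)) ->
   forall u : R -> R -> R, differentiable_plane u ->
   (forall x t : R, in_interval lo hi (u x t)) ->
   (solves_ivp a b f phi u <->
      (forall x : R, u x 0 = phi x) /\
      (forall (x0 : R) (T1 T2 : Rbar) (x : R -> R),
         characteristic a x0 T1 T2 x ->
         forall t : R, in_interval T1 T2 t -> reduced_equation b f u x t)) /\
   (solves_ivp a b f phi u <->
      (forall (x0 : R) (T1 T2 : Rbar) (x : R -> R),
         characteristic a x0 T1 T2 x ->
         forall t : R, in_interval T1 T2 t ->
           implicit_equation b phi F x0 x t (u (x t) t)))).
Proof.
split.
- intros u Hu x0 T1 T2 x Hx; split.
  { intros t Ht; now apply pde_along_characteristic with a phi x0 T1 T2. }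
  intros Hrange t Ht.
  assert (Hred : forall s, in_interval T1 T2 s -> reduced_equation b f u x s).
  { intros s Hs; apply reduced_along_characteristic with a phi x0 T1 T2; auto. }
  split; [now apply Hred|split].
  + destruct (Hred t Ht) as [du [Hdu <-]].
    exact (is_derive_antiderivative_comp f F (fun s => u (x s) s) lo hi t du
             hF (Hrange t Ht) Hdu).
  + intros v Hv.
    assert (Hi : implicit_equation b phi F x0 x t (u (x t) t)).
    { refine (proj1 (reduced_iff_implicit a b f phi F lo hi u x0 T1 T2 x
                       hb hF _ _ Hx Hrange) Hred t Ht); apply Hu. }
    split; [|now intros ->].
    intros Hiv.
    apply (antiderivative_inj f F lo hi hf hF); [exact Hv|now apply Hrange|].
    unfold implicit_equation in Hi, Hiv; congruence.
- intros Hcov Hphi u Hu Hrange.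
  assert (Hfu : forall x t, f (u x t) <> 0) by (intros; now apply hf).
  assert (Hreduced : solves_ivp a b f phi u <->
      (forall x : R, u x 0 = phi x) /\
      (forall (x0 : R) (T1 T2 : Rbar) (x : R -> R),
         characteristic a x0 T1 T2 x ->
         forall t : R, in_interval T1 T2 t -> reduced_equation b f u x t)).
  { split.
    - intros Hs; split; [apply Hs|].
      intros x0 T1 T2 x Hx t Ht.
      now apply reduced_along_characteristic with a phi x0 T1 T2.
    - intros [Hinit Hred]; now apply solves_ivp_of_reduced. }
  split; [exact Hreduced|].
  rewrite Hreduced; split.
  + intros [Hinit Hred] x0 T1 T2 x Hx.
    apply (reduced_iff_implicit a b f phi F lo hi u x0 T1 T2 x); auto.
    exact (Hred x0 T1 T2 x Hx).
  + intros Himp.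
    assert (Hinit : forall x, u x 0 = phi x)
      by now apply (initial_condition_of_implicit a b f phi F lo hi u).
    split; [exact Hinit|].
    intros x0 T1 T2 x Hx.
    apply (reduced_iff_implicit a b f phi F lo hi u x0 T1 T2 x); auto.
    exact (Himp x0 T1 T2 x Hx).
Qed.
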